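(* Consider a Bounded Knapsack Problem instance with items $\{1,\dots,n\}$ (positive integer profits $p_i$, weights $w_i$, availabilities $d_i$), capacity $W$, items indexed in non-increasing order of efficiency $p_i/w_i$, break item $b$, incumbent value $z$, and unfixed availability vector $u$ (as in the context). Let $\widehat p=\sum_{i<b}d_ip_i$, $\widehat w=\sum_{i<b}d_iw_i$, and for a left item $i$ (i.e. $i<b$) and integer $e\ge 0$ define the weak upper bound $$WB(i,e)=\widehat p-e\,p_i+\bigl(W-\widehat w+e\,w_i\bigr)\frac{p_b}{w_b}.$$ Let $I^1_{\text{left}}$ be the set of left items $i$ with $u_i=1$. Suppose that for every $i\in I^1_{\text{left}}$ we have $WB(i,1)\ge z+1$ and $WB(i,2)<z+1$. Then no two distinct items $i,i'\in I^1_{\text{left}}$ can be removed simultaneously while maintaining a weak upper bound of at least $z+1$, i.e. for all distinct $i,i'\in I^1_{\text{left}}$, $$\widehat p-p_i-p_{i'}+\bigl(W-\widehat w+w_i+w_{i'}\bigr)\frac{p_b}{w_b}<z+1.$$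
   Context: The break item $b$ is the index with $\sum_{i<b}d_iw_i\le W<\sum_{i\le b}d_iw_i$; items $i<b$ are left items and items $i\ge b$ right items. An improved solution is an integer $x$ with $0\le x_i\le d_i$, $\sum_iw_ix_i\le W$ and $\sum_ip_ix_i\ge z+1$. The unfixed availability vector $u\in\mathbb{Z}^n$, $0\le u_i\le d_i$, is such that every improved solution satisfies $d_i-u_i\le x_i\le d_i$ for left items $i$ and $x_i\le u_i$ for right items $i$. *)

(* Defs.v *)
From mathcomp Require Import all_boot all_order all_algebra.

Set Implicit Arguments.
Unset Strict Implicit.
Unset Printing Implicit Defensive.

Import Order.TTheory GRing.Theory Num.Theory.
Local Open Scope ring_scope.

(* Items 1, ..., n are represented, in the same order, by 0, ..., n - 1 in
   'I_n. *)
Record bkp (n : nat) := BKP {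
  profit : 'I_n -> int;
  weight : 'I_n -> int;
  avail : 'I_n -> int;
  capacity : int;
  profit_gt0 : forall i, 0 < profit i;
  weight_gt0 : forall i, 0 < weight i;
  avail_gt0 : forall i, 0 < avail i }.

Section Knapsack.
Variables (n : nat) (K : bkp n).
Implicit Types (x u : 'I_n -> int) (b i : 'I_n) (z : int) (e : nat).

Definition efficiency i : rat := (profit K i)%:Q / (weight K i)%:Q.

Definition sorted_by_efficiency : Prop :=
  forall i j : 'I_n, (i <= j)%N -> efficiency j <= efficiency i.

Definition feasible x : Prop :=
  (forall i, 0 <= x i <= avail K i) /\
  \sum_i weight K i * x i <= capacity K.

Definition total_profit x : int := \sum_i profit K i * x i.

Definition incumbent_value z : Prop :=
  exists2 x, feasible x & total_profit x = z.

Definition improved_solution z x : Prop :=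
  feasible x /\ z + 1 <= total_profit x.

Definition left_profit b : int :=
  \sum_(i < n | (i < b)%N) avail K i * profit K i.

Definition left_weight b : int :=
  \sum_(i < n | (i < b)%N) avail K i * weight K i.

Definition break_item b : Prop :=
  left_weight b <= capacity K
  < \sum_(i < n | (i <= b)%N) avail K i * weight K i.

Definition unfixed_availability b z u : Prop :=
  (forall i, 0 <= u i <= avail K i) /\
  (forall x, improved_solution z x ->
     forall i, if (i < b)%N then avail K i - u i <= x i <= avail K i
               else x i <= u i).

Definition weak_bound b i e : rat :=
  (left_profit b)%:Q - e%:R * (profit K i)%:Q
  + ((capacity K)%:Q - (left_weight b)%:Q + e%:R * (weight K i)%:Q)
    * efficiency b.

Definition left_unit_items b u : {set 'I_n} :=
  [set i : 'I_n | (i < b)%N & u i == 1].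

End Knapsack.

(* Main.v *)
(* The weak bound is affine in the number of removed items, so the bound for
   removing i and i' is the average of WB(i, 2) and WB(i', 2), both of which
   are below z + 1. *)
Require Import Defs.
From mathcomp Require Import all_boot all_order all_algebra.
From mathcomp Require Import lra.

Set Implicit Arguments.
Unset Strict Implicit.
Unset Printing Implicit Defensive.

Import Order.TTheory GRing.Theory Num.Theory.
Local Open Scope ring_scope.

Theorem theorem2 (n : nat) (K : bkp n) (b : 'I_n) (z : int) (u : 'I_n -> int)
  (sortedK : sorted_by_efficiency K)
  (breakb : break_item K b)
  (incumbentz : incumbent_value K z)
  (unfixedu : unfixed_availability K b z u)
  (WB_left : forall i : 'I_n, i \in left_unit_items b u ->
     z%:Q + 1 <= weak_bound K b i 1 /\ weak_bound K b i 2 < z%:Q + 1) :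
  forall i i' : 'I_n,
    i \in left_unit_items b u -> i' \in left_unit_items b u -> i != i' ->
    (left_profit K b)%:Q - (profit K i)%:Q - (profit K i')%:Q
    + ((capacity K)%:Q - (left_weight K b)%:Q
       + (weight K i)%:Q + (weight K i')%:Q)
      * ((profit K b)%:Q / (weight K b)%:Q)
    < z%:Q + 1.
Proof.
move=> i i' /WB_left[_ WB2i] /WB_left[_ WB2i'] _.
move: WB2i WB2i'; rewrite /weak_bound /efficiency.
(* The quotient is the same in both bounds and in the goal, so it is abstracted to [c]. With the
   products of [c] with the capacity and the weights taken as atoms, everything is linear: the goal
   is half the sum of the two strict inequalities for [e = 2], and the sign of [c] does not
   matter. *)
set c := _ / (weight K b)%:Q; nra.
Qed.
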